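(* Let $B_1,\dots,B_p$ be real $d\times d$ matrices with $B_i^T+B_i\le 0$ for $i=1,\dots,p$, and let $u$ be an input. For all $x\in\mathbb{R}^d$, the set $\Omega_u(x)$ is included in $F_u=\bigcup_{i\in J_u}\mathcal{K}_i$, and moreover $$\forall i\in J_u\qquad \Omega_u(x)\cap\mathcal{K}_i\neq\emptyset.$$
   Context: For a symmetric matrix $Q$, $Q\le 0$ means $x^TQx\le 0$ for all $x\in\mathbb{R}^d$. An input (switching signal) is a piecewise constant, right-continuous function $u:[0,+\infty[\to\{1,\dots,p\}$, with switching times $(a_n)_{n\ge0}$, $a_0=0$, strictly increasing to $+\infty$; $u$ is constant, equal to $u_n$, on $[a_n,a_{n+1}[$, and $\delta_n=a_{n+1}-a_n$. The solution of $\dot x=B_{u(t)}x$ from $x$ is $t\mapsto\Phi_u(t)x$, where $\Phi_u(t)=\exp((t-a_n)B_{u_n})\exp(\delta_{n-1}B_{u_{n-1}})\cdots\exp(\delta_0B_{u_0})$ for $t\in[a_n,a_{n+1}[$. $\Omega_u(x)$ is the set of limits of sequences $(\Phi_u(t_k)x)_{k\ge0}$ with $(t_k)$ strictly increasing to $+\infty$. For each $i$, $\mathcal{K}_i=\ker(B_i^T+B_i)$. With $m$ the Lebesgue measure on the real line, $J_u=\{i\in\{1,\dots,p\};\ m\{t\ge0;\ u(t)=i\}=+\infty\}$. *)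

(* Defs.v *)
From HB Require Import structures.
From mathcomp Require Export all_boot all_order all_algebra.
From mathcomp Require Export all_classical all_reals all_analysis.

Set Implicit Arguments.
Unset Strict Implicit.
Unset Printing Implicit Defensive.

Export Order.TTheory GRing.Theory Num.Theory.
Export numFieldNormedType.Exports.

Local Open Scope classical_set_scope.
Local Open Scope ring_scope.

Definition mx_nonpos (R : realType) (d : nat) (Q : 'M[R]_d) : Prop :=
  forall x : 'cV[R]_d, (x^T *m Q *m x) 0 0 <= 0.

(* The limit is taken in the library's topology on matrices, i.e. entrywise. *)
Definition expmx (R : realType) (d : nat) (A : 'M[R]_d) : 'M[R]_d :=
  limn (series (fun k : nat => (k`!%:R)^-1 *: A ^+ k)).

(* Only the values of [signal] on [0, +oo[ are meaningful; the mode labels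
   1, ..., p are represented by 'I_p.  Consecutive values are allowed to
   coincide, so that eventually constant signals are inputs as well. *)
Record input (R : realType) (p : nat) := Input {
  signal :> R -> 'I_p;
  switch : nat -> R;
  switch0 : switch 0%N = 0;
  switch_incr : increasing_seq switch;
  switch_cvgy : switch n @[n --> \oo] --> +oo;
  signal_switch : forall (n : nat) (t : R),
    switch n <= t < switch n.+1 -> signal t = signal (switch n)
}.

Section SwitchedSystem.
Variables (R : realType) (d p : nat) (B : 'I_p -> 'M[R]_d) (u : input R p).

(* For 0 <= t, the unique n such that t lies in [a_n, a_{n+1}[. *)
Definition switch_index (t : R) : nat :=
  xget 0%N [set n | switch u n <= t < switch u n.+1].

Fixpoint flow_at_switch (n : nat) : 'M[R]_d :=
  if n is k.+1 then
    expmx ((switch u k.+1 - switch u k) *: B (u (switch u k)))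
      *m flow_at_switch k
  else 1%:M.

Definition flow (t : R) : 'M[R]_d :=
  let n := switch_index t in
  expmx ((t - switch u n) *: B (u (switch u n))) *m flow_at_switch n.

Definition omega_limit (x : 'cV[R]_d) : set 'cV[R]_d :=
  [set y | exists t : nat -> R,
    [/\ forall k, 0 <= t k, increasing_seq t, t k @[k --> \oo] --> +oo &
        flow (t k) *m x @[k --> \oo] --> y]].

Definition sym_kernel (i : 'I_p) : set 'cV[R]_d :=
  [set x | ((B i)^T + B i) *m x = 0].

Definition persistent_modes : set 'I_p :=
  [set i | lebesgue_measure [set t : R | 0 <= t /\ u t = i] = +oo%E].

End SwitchedSystem.

(* Main.v *)
Require Import Defs.
From mathcomp Require Import ring lra.

(** Write [X t] for the trajectory [flow B u t *m x] and [Q i] for the symmetric matrix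
    [(B i)^T + B i]. The squared norm of [X] is a Lyapunov function: while mode [i] is
    active, its derivative is the value at [X t] of the quadratic form of [Q i], which
    is nonpositive. Only a finite amount of squared norm can be dissipated in total, and
    the theorem expresses two consequences of this.

    A limit point [y] that lies in no kernel of a persistent mode cannot exist
    ([omega_limit_sub_kernels]): since a nonpositive form vanishes only on the kernel of
    its matrix ([qform_eq0_kernel]), all persistent modes dissipate at a uniform rate
    near [y]. The trajectory has bounded speed, so each visit near [y] lasts a fixed
    time, and at late times nearly all of it is spent in persistent modes. Infinitely many
    visits would dissipate an infinite amount.

    Conversely, a persistent mode [i] is active for an infinite time, so the dissipation
    it would cause cannot stay bounded away from zero ([dissipation_vanishes]);
    the states at which it is nearly zero accumulate, by compactness, at a limit point in
    the kernel of [Q i] ([omega_limit_cap_kernel]).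

    Energy balances take the form of monotonicity statements: the time spent in each
    mode is recorded by a clock ([occupation_time]), and every estimate says that some combination of the squared
    norm and of the clocks is monotone ([energy_dissipation]). Such a statement is
    checked on each interval between switches by the mean value theorem and then glued
    ([piecewise_derive_nincr]); it uses that the matrix exponential solves the linear
    equation, which follows from termwise differentiation of its entries
    ([is_derive_expmx_coord]). *)

Set Implicit Arguments.
Unset Strict Implicit.
Unset Printing Implicit Defensive.

Local Open Scope classical_set_scope.
Local Open Scope ring_scope.

(** * Sums and entrywise limits *)

Lemma ler_sum_term (R : numDomainType) (I : finType) (F : I -> R) (i : I) :
  (forall j, 0 <= F j) -> F i <= \sum_j F j.
Proof. by move=> F0; rewrite (bigD1 i)//= lerDl sumr_ge0. Qed.

Lemma cvg_mx_coord (R : realType) (m n : nat) (T : Type) (F : set_system T)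
    (FF : Filter F) (f : T -> 'M[R]_(m, n)) (M : 'M[R]_(m, n)) :
  f x @[x --> F] --> M <-> forall i j, f x i j @[x --> F] --> M i j.
Proof.
split=> [fM i j|fM].
  exact: (cvg_comp _ _ fM (@coord_continuous _ _ _ i j M)).
move=> A [P MP sPA]; rewrite /= /nbhs /=.
apply: (filterS (P := fun x => forall ij, P ij.1 ij.2 (f x ij.1 ij.2))).
  by move=> x Px; apply: sPA => i j; exact: (Px (i, j)).
by apply: filter_forall => -[i j]; exact: fM.
Qed.

(** * The exponential of a matrix *)

Section MatrixExponential.
Variables (R : realType) (d : nat).
Implicit Types (A : 'M[R]_d) (t : R).

Lemma normr_exprmx_le A (b : R) : (forall i j, `|A i j| <= b) ->
  forall k i j, `|(A ^+ k) i j| <= (d%:R * b) ^+ k.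
Proof.
move=> Ab; elim=> [|k IH] i j.
  by rewrite !expr0 mxE; case: (i == j); rewrite ?normr1 ?normr0.
have b0 : 0 <= b by rewrite (le_trans _ (Ab i j)).
rewrite exprS mxE (le_trans (ler_norm_sum _ _ _))//.
have -> : (d%:R * b) ^+ k.+1 = \sum_(l < d) b * (d%:R * b) ^+ k.
  by rewrite sumr_const card_ord -[RHS]mulr_natl exprS mulrA.
by apply: ler_sum => l _; rewrite normrM ler_pM.
Qed.

Lemma exprmxZ t A k : (t *: A) ^+ k = t ^+ k *: A ^+ k.
Proof.
elim: k => [|k IH]; first by rewrite !expr0 scale1r.
rewrite !exprS IH.
by rewrite -[LHS]/((t *: A) *m (t ^+ k *: A ^+ k)) -scalemxAl -scalemxAr scalerA.
Qed.

Definition expmx_coef A i j (k : nat) : R := (k`!%:R)^-1 * (A ^+ k) i j.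

(** If every entry of [A] is at most [b] in norm, the [k]-th term is at most
    [(d b |t|)^k / k!], a term of a scalar exponential series. *)
Lemma is_cvg_pseries_expmx_coef A i j t : cvgn (pseries (expmx_coef A i j) t).
Proof.
pose b := \sum_i \sum_j `|A i j|.
have Ab i' j' : `|A i' j'| <= b.
  apply: le_trans (ler_sum_term i' _) => [|l]; last exact: sumr_ge0.
  exact: (ler_sum_term (F := fun l => `|A i' l|)).
apply: normed_cvg.
apply: (@series_le_cvg _ _ (exp_coeff (d%:R * b * `|t|))).
- by move=> k /=.
- move=> k; apply: exp_coeff_ge0; rewrite mulr_ge0 ?mulr_ge0// /b.
  by rewrite sumr_ge0// => ? _; rewrite sumr_ge0.
- move=> k; rewrite /expmx_coef /exp_coeff /= !normrM normrX normfV.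
  rewrite (ger0_norm (_ : 0 <= k`!%:R))// [leRHS]mulrC -mulrA ler_wpM2l ?invr_ge0//.
  by rewrite [leRHS]exprMn ler_wpM2r ?exprn_ge0// normr_exprmx_le.
- exact: is_cvg_series_exp_coeff.
Qed.

(** Each entry of [expmx (t *: A)] is a scalar power series in [t], so that the
    termwise differentiation of power series applies to the matrix exponential. *)
Lemma expmx_coord A i j t :
  expmx (t *: A) i j = limn (pseries (expmx_coef A i j) t).
Proof.
pose s n := series (fun k : nat => (k`!%:R)^-1 *: (t *: A) ^+ k) n.
have coordE i' j' : (fun n => s n i' j') = pseries (expmx_coef A i' j') t.
  apply/funext => n; rewrite /s /pseries /series /= summxE.
  by apply: eq_bigr => k _; rewrite exprmxZ !mxE /expmx_coef; ring.
have : s n @[n --> \oo] --> \matrix_(i', j') limn (pseries (expmx_coef A i' j') t).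
  apply/cvg_mx_coord => i' j'; rewrite mxE coordE.
  exact: is_cvg_pseries_expmx_coef.
by rewrite /expmx -/s => /cvg_lim ->//; rewrite mxE.
Qed.

(** Since [(k+1) A^(k+1) / (k+1)! = A (A^k / k!)], the differentiated series is
    the original one multiplied on the left by [A]. *)
Lemma pseries_diffs_expmx_coef A i j :
  pseries_diffs (expmx_coef A i j) = fun k => \sum_l A i l * expmx_coef A l j k.
Proof.
apply/funext => k; rewrite /pseries_diffs /expmx_coef.
rewrite exprS -[(A * A ^+ k)]/(A *m A ^+ k) mxE factS natrM invfM.
rewrite 2!mulrA mulfV ?pnatr_eq0// mul1r mulr_sumr.
by apply: eq_bigr => l _; rewrite mulrCA.
Qed.

Lemma cvg_expmx_coef A i j t : pseries (expmx_coef A i j) t @ \oo --> expmx (t *: A) i j.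
Proof. rewrite expmx_coord; exact: is_cvg_pseries_expmx_coef. Qed.

Lemma cvg_pseries_sum (I : Type) (r : seq I) (c : I -> R^nat) (a : I -> R) t
    (l : I -> R) :
  (forall i, pseries (c i) t @ \oo --> l i) ->
  pseries (fun k => \sum_(i <- r) a i * c i k) t @ \oo --> \sum_(i <- r) a i * l i.
Proof.
move=> cl.
have -> : pseries (fun k => \sum_(i <- r) a i * c i k) t
    = (fun n => \sum_(i <- r) a i * pseries (c i) t n).
  apply/funext => n; rewrite /pseries /series /=.
  under eq_bigr do rewrite mulr_suml.
  rewrite exchange_big /=; apply: eq_bigr => i _.
  by rewrite mulr_sumr; apply: eq_bigr => k _; rewrite mulrA.
apply: cvg_big => [|i _]; first exact: add_continuous.
by apply: cvgMr; exact: cl.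
Qed.

Lemma is_derive_expmx_coord A i j t :
  is_derive t 1 (fun s => expmx (s *: A) i j) ((A *m expmx (t *: A)) i j).
Proof.
have C1 k x : cvgn (pseries (pseries_diffs (expmx_coef A k j)) x).
  rewrite pseries_diffs_expmx_coef; apply: cvgP.
  by apply: cvg_pseries_sum => l; exact: cvg_expmx_coef.
have -> : (fun s => expmx (s *: A) i j) = (fun s => limn (pseries (expmx_coef A i j) s)).
  by apply/funext => s; exact: expmx_coord.
have -> : (A *m expmx (t *: A)) i j = limn (pseries (pseries_diffs (expmx_coef A i j)) t).
  apply/esym/cvg_lim => //; rewrite mxE pseries_diffs_expmx_coef.
  by apply: cvg_pseries_sum => l; exact: cvg_expmx_coef.
apply: (@pseries_snd_diffs _ _ (`|t| + 1)).
- exact: is_cvg_pseries_expmx_coef.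
- exact: C1.
- have -> : pseries_diffs (pseries_diffs (expmx_coef A i j)) =
      (fun k => \sum_l A i l * pseries_diffs (expmx_coef A l j) k).
    apply/funext => k; rewrite {1}/pseries_diffs pseries_diffs_expmx_coef.
    by rewrite mulr_sumr; apply: eq_bigr => l _; rewrite mulrCA.
  by apply: cvgP; apply: cvg_pseries_sum => l; exact: C1.
- by rewrite [ltRHS]ger0_norm ?addr_ge0// ltrDl.
Qed.

Lemma expmx0 : expmx (0 : 'M[R]_d) = 1%:M.
Proof.
apply/matrixP => i j; rewrite -[0](scale0r (0 : 'M[R]_d)) expmx_coord.
apply/cvg_lim => //; apply: cvg_near_cst.
exists 1%N => // -[//|n] _ /=.
rewrite /pseries /series /= big_nat_recl//= big1 ?addr0 => [|k _].
  by rewrite expr0 mulr1 /expmx_coef expr0 invr1 mul1r.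
by rewrite expr0n mulr0.
Qed.

End MatrixExponential.

(** * Gluing estimates across switching times *)

Section SwitchingTimes.
Variables (R : realType) (p : nat) (u : input R p).

Lemma ltr_switch m n : (switch u m < switch u n) = (m < n)%N.
Proof. exact: (leW_mono (@switch_incr _ _ u)). Qed.

Lemma switch_lt n : switch u n < switch u n.+1.
Proof. by rewrite ltr_switch. Qed.

Lemma switch_ge0 n : 0 <= switch u n.
Proof. by rewrite -(switch0 u) (@switch_incr _ _ u). Qed.

Lemma switch_unbounded t : exists n, t < switch u n.
Proof.
have /cvgryPgt /(_ t) [n _ nt] := @switch_cvgy _ _ u.
by exists n; apply: nt => /=.
Qed.

Lemma switch_itv t : 0 <= t -> exists n, switch u n <= t < switch u n.+1.
Proof.
move=> t0; have [n tn] := switch_unbounded t.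
elim: n tn => [|n IH] tn; first by move: tn; rewrite switch0 ltNge t0.
have [|ant] := ltP t (switch u n); first exact: IH.
by exists n; rewrite ant.
Qed.

Lemma switch_indexE n t : switch u n <= t < switch u n.+1 -> switch_index u t = n.
Proof.
move=> nt; rewrite /switch_index; case: xgetP => [m -> /= mt|/(_ n)//].
move: mt nt => /andP[m1 m2] /andP[n1 n2].
have := le_lt_trans m1 n2; have := le_lt_trans n1 m2.
by rewrite !ltr_switch !ltnS => nm mn; apply/eqP; rewrite eqn_leq mn.
Qed.

(** By induction on the piece that contains [t]: an estimate obtained on each
    piece alone propagates across the switches. *)
Lemma piecewise_nincr (f : R -> R) (s t : R) : 0 <= s -> s <= t ->
  (forall n r r', s <= r -> r <= r' -> r' <= t ->
     switch u n <= r -> r' <= switch u n.+1 -> f r' <= f r) ->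
  f t <= f s.
Proof.
move=> s0 st fdecr; have [n] := switch_unbounded t.
suff main r : s <= r -> r <= t -> r <= switch u n -> f r <= f s.
  by move=> /ltW; exact: main.
elim: n r => [|n IH] r sr rt rn.
  have -> : r = s by apply/le_anti; rewrite sr (le_trans rn)// switch0.
  exact: lexx.
have [rn'|nr] := leP r (switch u n); first exact: IH.
have [sn|ns] := leP s (switch u n).
  apply: (le_trans (fdecr n (switch u n) r sn (ltW nr) rt (lexx _) rn)).
  by apply: IH => //; rewrite (le_trans (ltW nr)).
exact: (fdecr n _ _ (lexx _) sr rt (ltW ns) rn).
Qed.

(** The form in which [piecewise_nincr] is used: on the closed piece [n], [f]
    agrees with a function [g n] that is differentiable on the whole line, and the
    mean value theorem gives the estimate there. The sign of the derivative is
    required only inside the pieces, where the active mode is the one of the piece;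
    at the right end of a piece the mode is already the next one. *)
Lemma piecewise_derive_nincr (f : R -> R) (g g' : nat -> R -> R) (s t : R) :
  0 <= s -> s <= t ->
  (forall n r, switch u n <= r <= switch u n.+1 -> f r = g n r) ->
  (forall n (r : R), is_derive r 1 (g n) (g' n r)) ->
  (forall n r, switch u n < r < switch u n.+1 -> s < r < t -> g' n r <= 0) ->
  f t <= f s.
Proof.
move=> s0 st fg dg g'0; apply: piecewise_nincr => // n r r' sr rr' r't nr r'n.
have [<-//|nrr'] := eqVneq r r'.
rewrite (fg n) ?(le_trans nr)// (fg n) ?nr ?(le_trans rr')//.
have lt_rr' : r < r' by rewrite lt_neqAle nrr'.
have gcont : {within `[r, r'], continuous (g n)}.
  apply: continuous_subspaceT => z; apply/differentiable_continuous.
  by apply/derivable1_diffP; exact: ex_derive.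
have [z + gE] := MVT lt_rr' (fun z _ => dg n z) gcont.
rewrite in_itv /= => /andP[rz zr'].
rewrite -subr_le0 gE mulr_le0_ge0// ?subr_ge0//.
apply: g'0.
  by rewrite (le_lt_trans nr rz) (lt_le_trans zr' r'n).
by rewrite (le_lt_trans sr rz) (lt_le_trans zr' r't).
Qed.

End SwitchingTimes.

(** * Trajectories between two switches *)

Section Trajectory.
Variables (R : realType) (d p : nat) (B : 'I_p -> 'M[R]_d) (u : input R p).

(** The closed piece is covered because the flow is continuous at the switch. *)
Lemma flow_piece n t : switch u n <= t <= switch u n.+1 ->
  flow B u t
    = expmx ((t - switch u n) *: B (u (switch u n))) *m flow_at_switch B u n.
Proof.
move=> /andP[nt]; rewrite le_eqVlt => /predU1P[->|tn].
  rewrite /flow (@switch_indexE _ _ _ n.+1) ?lexx ?switch_lt//.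
  by rewrite subrr scale0r expmx0 mul1mx.
by rewrite /flow (@switch_indexE _ _ _ n) ?nt.
Qed.

Lemma flow0 : flow B u 0 = 1%:M.
Proof.
rewrite (@flow_piece 0%N); last by rewrite switch0 lexx switch_ge0.
by rewrite switch0 subrr scale0r expmx0 mul1mx.
Qed.

(** The solution of the equation of mode [n] that agrees with the trajectory
    on the piece [n], defined and differentiable for all times. *)
Definition flow_branch n (x : 'cV[R]_d) (t : R) : 'cV[R]_d :=
  expmx ((t - switch u n) *: B (u (switch u n))) *m (flow_at_switch B u n *m x).

Lemma flow_branchE n x t : switch u n <= t <= switch u n.+1 ->
  flow B u t *m x = flow_branch n x t.
Proof. by move=> nt; rewrite (flow_piece nt) -mulmxA. Qed.

Lemma is_derive_flow_branch n x j (t : R) :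
  is_derive t 1 (fun s => flow_branch n x s j 0)
    ((B (u (switch u n)) *m flow_branch n x t) j 0).
Proof.
rewrite /flow_branch; set A := B _; set y := flow_at_switch _ _ _ *m x.
have -> : (fun s => (expmx ((s - switch u n) *: A) *m y) j 0)
    = \sum_(k < d)
        (y k 0 *: ((fun s => expmx (s *: A) j k) \o (fun s => s - switch u n))).
  apply/funext => s; rewrite fct_sumE mxE; apply: eq_bigr => k _.
  by rewrite mulrC.
rewrite mulmxA mxE; apply: is_derive_sum => k.
rewrite mulrC; apply: is_deriveZ.
rewrite -[X in is_derive _ _ _ X]mulr1.
apply: is_derive1_comp; first exact: is_derive_expmx_coord.
by apply: is_derive_eq; rewrite subr0.
Qed.

End Trajectory.

(** * Time spent in a mode *)

Section OccupationTime.
Variables (R : realType) (p : nat) (u : input R p).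
Local Notation mu := (@lebesgue_measure R).

Definition mode_set (i : 'I_p) : set R := [set t | 0 <= t /\ u t = i].

Lemma mode_set_before_switch i n t : switch u n <= t <= switch u n.+1 ->
  mode_set i `&` `[0, t[ = (mode_set i `&` `[0, switch u n[) `|`
    (if u (switch u n) == i then `[switch u n, t[%classic else set0).
Proof.
move=> /andP[nt tn]; apply/seteqP; split=> [r [[r0 <-]]|r].
  rewrite /= !in_itv /= => /andP[_ rt].
  have [rn|nr] := ltP r (switch u n); [left|right].
    by rewrite r0.
  by rewrite -(@signal_switch _ _ u n r) ?nr ?(lt_le_trans rt)// eqxx /= in_itv/= nr.
case=> [[ri]|].
  rewrite /= !in_itv /= => /andP[r0 rn]; split=> //.
  by rewrite r0 (lt_le_trans rn).
case: eqP => // ui; rewrite /= !in_itv /= => /andP[nr rt].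
have r0 : 0 <= r by rewrite (le_trans (switch_ge0 u n)).
split; last by rewrite r0.
by split=> //; rewrite (@signal_switch _ _ u n) ?nr ?(lt_le_trans rt).
Qed.

Lemma measurable_mode_set_before i n : measurable (mode_set i `&` `[0, switch u n[).
Proof.
elim: n => [|n IH]; first by rewrite switch0 set_itvco0 setI0.
rewrite (@mode_set_before_switch i n) ?lexx ?andbT ?(ltW (switch_lt u n))//.
by apply: measurableU => //; case: ifP.
Qed.

Lemma mode_set_bigcup i : mode_set i = \bigcup_n (mode_set i `&` `[0, switch u n[).
Proof.
apply/seteqP; split=> [r ri|r [n _ []//]].
have [n rn] := switch_unbounded u r.
by exists n => //; split=> //; rewrite /= in_itv /= rn (proj1 ri).
Qed.

Lemma measurable_mode_set i : measurable (mode_set i).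
Proof.
rewrite mode_set_bigcup; apply: bigcup_measurable => n _.
exact: measurable_mode_set_before.
Qed.

(** Measure of the times before [t] that are spent in mode [i]: a clock that runs
    at speed [1] when the mode is [i] and stops otherwise. *)
Definition occupation_time (i : 'I_p) (t : R) : R :=
  fine (mu (mode_set i `&` `[0, t[)).

Lemma measurable_mode_set_itv i t : measurable (mode_set i `&` `[0, t[).
Proof. by apply: measurableI => //; exact: measurable_mode_set. Qed.

Lemma occupation_timeE i t :
  (occupation_time i t)%:E = mu (mode_set i `&` `[0, t[).
Proof.
rewrite fineK// ge0_fin_numE//.
apply: (@le_lt_trans _ _ (mu `[0, t[)).
  by apply: le_measure; rewrite ?inE//; exact: measurable_mode_set_itv.
by rewrite lebesgue_measure_itv /=; case: ifP => _; rewrite -?EFinB ltry.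
Qed.

Lemma le_occupation_time i s t : s <= t ->
  occupation_time i s <= occupation_time i t.
Proof.
move=> st; rewrite -lee_fin !occupation_timeE.
apply: le_measure; rewrite ?inE; [exact: measurable_mode_set_itv..|].
by apply: setIS; apply: subset_itvl; rewrite bnd_simp.
Qed.

Lemma occupation_time_piece i n t : switch u n <= t <= switch u n.+1 ->
  occupation_time i t =
  occupation_time i (switch u n) + (u (switch u n) == i)%:R * (t - switch u n).
Proof.
move=> nt; apply: EFin_inj; rewrite EFinD !occupation_timeE.
rewrite (mode_set_before_switch _ nt) measureU//.
- congr (_ + _)%E; case: ifP => _; last by rewrite measure0 mul0r.
  rewrite [LHS]lebesgue_measure_itv /= mul1r lte_fin.
  case: ltP => //; move: nt => /andP[nt _] tn.
  by rewrite (le_anti (introT andP (conj nt tn))) subrr.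
- exact: measurable_mode_set_itv.
- by case: ifP.
- apply/seteqP; split=> // r [[_]] /=; rewrite in_itv /= => /andP[_ rn].
  by case: ifP => // _ /=; rewrite in_itv /= => /andP[]; rewrite leNgt rn.
Qed.

(** At each time exactly one of the clocks runs. *)
Lemma sum_occupation_time t : 0 <= t -> \sum_i occupation_time i t = t.
Proof.
have step n r : switch u n <= r <= switch u n.+1 ->
    \sum_i occupation_time i r =
    \sum_i occupation_time i (switch u n) + (r - switch u n).
  move=> nr; under eq_bigr do rewrite (occupation_time_piece _ nr).
  rewrite big_split /= -mulr_suml; congr (_ + _).
  rewrite (bigD1 (u (switch u n)))//= eqxx.
  by rewrite big1 ?addr0 ?mul1r// => i; rewrite eq_sym => /negPf ->.
have sumE n : \sum_i occupation_time i (switch u n) = switch u n.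
  elim: n => [|n IH].
    rewrite switch0 big1// => i _; apply: EFin_inj.
    by rewrite occupation_timeE set_itvco0 setI0 measure0.
  by rewrite (@step n) ?lexx ?andbT ?(ltW (switch_lt u n))// IH addrC subrK.
move=> /(switch_itv u)[n /andP[nt tn]].
by rewrite (@step n) ?nt ?ltW// sumE addrC subrK.
Qed.

Lemma occupation_time_le_measure i t : (mu (mode_set i) < +oo)%E ->
  occupation_time i t <= fine (mu (mode_set i)).
Proof.
move=> fin; rewrite -lee_fin occupation_timeE fineK ?ge0_fin_numE//.
apply: le_measure; rewrite ?inE//.
  exact: measurable_mode_set_itv.
exact: measurable_mode_set.
Qed.

(** The mode set is the increasing union of its parts before the switches, and the
    measure is continuous along it: a bounded clock would bound the total measure. *)
Lemma occupation_time_unbounded i (M : R) : mu (mode_set i) = +oo%E ->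
  exists2 t, 0 <= t & M < occupation_time i t.
Proof.
move=> infi; apply: contrapT => noM.
have bnd n : (mu (mode_set i `&` `[0%R, switch u n[) <= M%:E)%E.
  rewrite -occupation_timeE lee_fin leNgt; apply/negP => Mn.
  by apply: noM; exists (switch u n) => //; exact: switch_ge0.
have : mu (mode_set i `&` `[0, switch u n[) @[n --> \oo] --> mu (mode_set i).
  rewrite {2}mode_set_bigcup; apply: nondecreasing_cvg_mu.
  - by move=> n; exact: measurable_mode_set_before.
  - by rewrite -mode_set_bigcup; exact: measurable_mode_set.
  - move=> m n mn; apply/subsetPset; apply: setIS; apply: subset_itvl.
    by rewrite bnd_simp (@switch_incr _ _ u).
move=> cv; have : (mu (mode_set i) <= M%:E)%E.
  rewrite -(cvg_lim _ cv)//; apply: lime_le; first by apply/cvg_ex; eexists; exact: cv.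
  by apply: nearW.
by rewrite infi leye_eq.
Qed.

End OccupationTime.

(** * Quadratic forms *)

Section QuadraticForm.
Variables (R : realType) (d : nat).
Implicit Types (Q : 'M[R]_d) (z : 'cV[R]_d).

Definition qform Q z : R := (z^T *m Q *m z) 0 0.

Definition sqnorm z : R := \sum_j z j 0 ^+ 2.

Lemma sqnorm_ge0 z : 0 <= sqnorm z.
Proof. by apply: sumr_ge0 => j _; exact: sqr_ge0. Qed.

Lemma sqnorm_eq0 z : sqnorm z = 0 -> z = 0.
Proof.
move=> /psumr_eq0P z0; apply/matrixP => j k; rewrite ord1 mxE.
by apply/eqP; rewrite -(sqrf_eq0 (z j 0)) z0// => l _; exact: sqr_ge0.
Qed.

Lemma normr_coord_le z j : `|z j 0| <= 1 + sqnorm z.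
Proof.
have : z j 0 ^+ 2 <= sqnorm z.
  by apply: (ler_sum_term (F := fun l => z l 0 ^+ 2)) => l; exact: sqr_ge0.
by rewrite -real_normK ?num_real//; have := normr_ge0 (z j 0); nra.
Qed.

Lemma sqnormE z : sqnorm z = (z^T *m z) 0 0.
Proof. by rewrite mxE; apply: eq_bigr => j _; rewrite mxE expr2. Qed.

(** The right-hand side is the derivative of [sqnorm] along [x' = B x]. *)
Lemma qform_symE B z : qform (B^T + B) z = \sum_j 2 * z j 0 * (B *m z) j 0.
Proof.
have bilinE : (z^T *m (B *m z)) 0 0 = \sum_j z j 0 * (B *m z) j 0.
  by rewrite mxE; apply: eq_bigr => j _; rewrite mxE.
have symE : z^T *m B^T *m z = (z^T *m (B *m z))^T.
  by rewrite !trmx_mul trmxK.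
rewrite /qform mulmxDr mulmxDl mxE symE -mulmxA mxE bilinE.
by rewrite -big_split /=; apply: eq_bigr => j _; ring.
Qed.

Lemma continuous_qform Q : continuous (qform Q).
Proof.
have -> : qform Q = fun z => \sum_k (\sum_l z l 0 * Q l k) * z k 0.
  apply/funext => z; rewrite /qform mxE; apply: eq_bigr => k _; congr (_ * _).
  by rewrite mxE; apply: eq_bigr => l _; rewrite mxE.
move=> z; rewrite /continuous_at.
apply: (@cvg_big _ _ _ _ _ _ _ (nbhs z)) => [|k _]; first exact: add_continuous.
apply: cvgM; last exact: coord_continuous.
apply: (@cvg_big _ _ _ _ _ _ _ (nbhs z)) => [|l _]; first exact: add_continuous.
by apply: cvgMl; exact: coord_continuous.
Qed.

(** A semidefinite form vanishes only on the kernel of its matrix: at a zero [z] it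
    is maximal, so its gradient [2 Q z] vanishes. Explicitly, moving from [z] by
    [e Q z] changes the value by [2 e |Q z|^2 + O(e^2)], which is positive for some
    small [e] unless [Q z = 0]. *)
Lemma qform_eq0_kernel Q z : Q^T = Q -> mx_nonpos Q -> qform Q z = 0 ->
  Q *m z = 0.
Proof.
move=> Qsym Qnonpos Qz0; apply: sqnorm_eq0.
set w := Q *m z; set s := sqnorm w; set q := qform Q w.
have perturb e : qform Q (z + e *: w) = 2 * e * s + e ^+ 2 * q.
  have wE : (z^T *m Q) = w^T by rewrite /w trmx_mul Qsym.
  have trE : (z + e *: w)^T = z^T + e *: w^T.
    by apply/matrixP => i j; rewrite !mxE.
  rewrite /qform trE -mulmxA mulmxDr -/w -scalemxAr mulmxDl !mulmxDr.
  rewrite -!scalemxAl -!scalemxAr.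
  have addE (M N : 'M[R]_1) : (M + N) 0 0 = M 0 0 + N 0 0 by rewrite mxE.
  have scaleE a (M : 'M[R]_1) : (a *: M) 0 0 = a * M 0 0 by rewrite mxE.
  rewrite !(addE, scaleE).
  have -> : (z^T *m w) 0 0 = 0 by rewrite -Qz0 /qform -mulmxA.
  have -> : (z^T *m (Q *m w)) 0 0 = s by rewrite mulmxA wE -sqnormE.
  have -> : (w^T *m (Q *m w)) 0 0 = q by rewrite mulmxA.
  by rewrite -sqnormE -/s; ring.
have s0 : 0 <= s := sqnorm_ge0 _.
have q0 : q <= 0 := Qnonpos w.
(* This step makes the value equal to [s^2 (2 - q) / (1 - q)^2]. *)
have := Qnonpos (z + (s / (1 - q)) *: w); rewrite -/(qform _ _) perturb.
have q1 : 0 < 1 - q by lra.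
have -> : 2 * (s / (1 - q)) * s + (s / (1 - q)) ^+ 2 * q
    = s ^+ 2 * ((2 - q) / (1 - q) ^+ 2) by field; rewrite gt_eqF.
rewrite pmulr_lle0; last by rewrite divr_gt0 ?exprn_gt0//; lra.
by move=> s2; apply/eqP; rewrite -(sqrf_eq0 s); apply/eqP/le_anti; rewrite s2 sqr_ge0.
Qed.

End QuadraticForm.

(** * Dissipation of the squared norm *)

Lemma is_derive_affine (R : realType) (a b c r : R) :
  is_derive r 1 (fun s => a + b * (s - c)) b.
Proof.
have -> : (fun s => a + b * (s - c)) = b *: id + cst (a - b * c).
  by apply/funext => s; rewrite !fctE /= -[b *: s]/(b * s); ring.
apply: (is_derive_eq (is_deriveD (is_deriveZ b (is_derive_id r 1))
  (is_derive_cst _ r 1))).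
by rewrite addr0 -[b *: 1]/(b * 1) mulr1.
Qed.

Section Energy.
Variables (R : realType) (d p : nat) (B : 'I_p -> 'M[R]_d) (u : input R p).
Variable x : 'cV[R]_d.
Local Notation X t := (flow B u t *m x).
Local Notation Q i := ((B i)^T + B i).

Lemma is_derive_sqnorm_branch n (r : R) :
  is_derive r 1 (fun s => sqnorm (flow_branch B u n x s))
    (qform (Q (u (switch u n))) (flow_branch B u n x r)).
Proof.
have -> : (fun s => sqnorm (flow_branch B u n x s))
    = \sum_(j < d) (fun s => flow_branch B u n x s j 0) ^+ 2.
  by apply/funext => s; rewrite fct_sumE.
rewrite qform_symE; apply: is_derive_sum => j.
have dy := is_derive_flow_branch B u n x j r.
have := is_deriveX 2 dy; rewrite expr1; exact.
Qed.

(** The energy balance on which both halves of the theorem rest. The squared norm has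
    derivative [qform (Q (u r)) (X r)] and the weighted sum of clocks has derivative
    [w (u r)], so their sum decreases as long as these rates add up to at most [0]:
    where the form is at most [- w (u r)], each unit of time spent in mode [i] costs
    at least [w i] of squared norm. *)
Lemma energy_dissipation (w : 'I_p -> R) s t : 0 <= s -> s <= t ->
  (forall r, s < r < t -> qform (Q (u r)) (X r) + w (u r) <= 0) ->
  sqnorm (X t) + \sum_i w i * occupation_time u i t <=
  sqnorm (X s) + \sum_i w i * occupation_time u i s.
Proof.
move=> s0 st diss.
pose g n r := sqnorm (flow_branch B u n x r) +
   \sum_i w i * (occupation_time u i (switch u n) +
                 (u (switch u n) == i)%:R * (r - switch u n)).
pose g' n r := qform (Q (u (switch u n))) (flow_branch B u n x r) + w (u (switch u n)).
apply: (@piecewise_derive_nincr _ _ u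
  (fun t => sqnorm (X t) + \sum_i w i * occupation_time u i t) g g') => //.
- move=> n r nr; rewrite /g (flow_branchE _ _ nr); congr (_ + _).
  by apply: eq_bigr => i _; rewrite (occupation_time_piece _ nr).
- move=> n r; rewrite /g /g'.
  have -> : (fun r0 : R => sqnorm (flow_branch B u n x r0) +
     \sum_i w i * (occupation_time u i (switch u n) +
      (u (switch u n) == i)%:R * (r0 - switch u n))) =
    (fun s => sqnorm (flow_branch B u n x s)) +
    (fun s => \sum_i w i * occupation_time u i (switch u n) +
     w (u (switch u n)) * (s - switch u n)).
    apply/funext => a; rewrite fctE; congr (_ + _).
    under eq_bigr do rewrite mulrDr.
    rewrite big_split /=; congr (_ + _).
    rewrite (bigD1 (u (switch u n)))//= eqxx mul1r big1 ?addr0// => i.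
    by rewrite eq_sym => /negPf ->; rewrite mul0r mulr0.
  exact: (is_deriveD (is_derive_sqnorm_branch n r) (is_derive_affine _ _ _ r)).
- move=> n r /andP[nr rn] srt; rewrite /g'.
  have unr : u (switch u n) = u r.
    by apply/esym/signal_switch; rewrite (ltW nr).
  rewrite unr -flow_branchE ?(ltW nr) ?(ltW rn)//; exact: diss.
Qed.

Hypothesis B_dissipative : forall i, mx_nonpos (Q i).

Lemma sqnorm_flow_nincr s t : 0 <= s -> s <= t -> sqnorm (X t) <= sqnorm (X s).
Proof.
move=> s0 st; have := @energy_dissipation (fun=> 0) _ _ s0 st.
rewrite !big1 ?addr0; [|by move=> ? _; rewrite mul0r..].
by apply=> r _; rewrite addr0; exact: B_dissipative.
Qed.

Lemma normr_flow_le t j : 0 <= t -> `|X t j 0| <= 1 + sqnorm x.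
Proof.
move=> t0; rewrite (le_trans (normr_coord_le _ _))// lerD2l.
by have := sqnorm_flow_nincr (lexx 0) t0; rewrite flow0 mul1mx.
Qed.

(** The trajectory is bounded and there are finitely many modes, so its velocity is
    bounded. *)
Lemma flow_lipschitz : exists2 L, 0 < L & forall s t j, 0 <= s -> s <= t ->
  `|X t j 0 - X s j 0| <= L * (t - s).
Proof.
pose L := 1 + \sum_i \sum_j \sum_k `|B i j k| * (1 + sqnorm x).
have L0 : 0 < L.
  rewrite /L ltr_pwDl// sumr_ge0// => i _; rewrite sumr_ge0// => j _.
  by rewrite sumr_ge0// => k _; rewrite mulr_ge0// addr_ge0// sqnorm_ge0.
have BL i j t : 0 <= t -> `|(B i *m X t) j 0| <= L.
  move=> t0; rewrite mxE (le_trans (ler_norm_sum _ _ _))//.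
  have term_ge0 i' j' k' : 0 <= `|B i' j' k'| * (1 + sqnorm x).
    by rewrite mulr_ge0// addr_ge0// sqnorm_ge0.
  apply: (@le_trans _ _ (\sum_k `|B i j k| * (1 + sqnorm x))).
    by apply: ler_sum => k _; rewrite normrM ler_wpM2l// normr_flow_le.
  apply: ler_wpDl => //.
  apply: le_trans (ler_sum_term i _) => [|i']; last first.
    by do !(apply: sumr_ge0 => ? _).
  apply: (ler_sum_term (F := fun j => \sum_k `|B i j k| * (1 + sqnorm x)) j) => j'.
  by apply: sumr_ge0 => ? _.
(* [e] is a sign: both one-sided bounds come from the same monotonicity. *)
have onesided (e : R) s t j : `|e| = 1 -> 0 <= s -> s <= t ->
    e * X t j 0 - L * t <= e * X s j 0 - L * s.
  move=> e1 s0 st.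
  apply: (@piecewise_derive_nincr _ _ u (fun t => e * X t j 0 - L * t)
    (fun n r => e * flow_branch B u n x r j 0 - L * r)
    (fun n r => e * (B (u (switch u n)) *m flow_branch B u n x r) j 0 - L)) => //.
  - by move=> n r nr; rewrite (flow_branchE _ _ nr).
  - move=> n r.
    have -> : (fun r => e * flow_branch B u n x r j 0 - L * r)
       = e *: (fun r => flow_branch B u n x r j 0) - L *: id by [].
    apply: is_deriveB; first by apply: is_deriveZ; exact: is_derive_flow_branch.
    by apply: is_derive_eq; exact: mulr1.
  - move=> n r /andP[nr rn] /andP[sr _].
    rewrite -flow_branchE ?(ltW nr) ?(ltW rn)// subr_le0 (le_trans (ler_norm _))//.
    by rewrite normrM e1 mul1r BL// (le_trans s0 (ltW sr)).
exists L => // s t j s0 st; rewrite ler_norml.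
have := @onesided 1 s t j (normr1 _) s0 st.
have := @onesided (-1) s t j _ s0 st; rewrite normrN1 => /(_ erefl).
by rewrite !mul1r !mulN1r => *; apply/andP; split; lra.
Qed.

End Energy.

(** * Monotone functions and bounded sequences *)

(** Beyond a time where [f] is within [e] of its supremum, it cannot grow by [e]. *)
Lemma bounded_ndecr_increment (R : realType) (f : R -> R) (M e : R) : 0 < e ->
  (forall s t, 0 <= s -> s <= t -> f s <= f t) ->
  (forall t, 0 <= t -> f t <= M) ->
  exists2 T, 0 <= T & forall s t, T <= s -> s <= t -> f t < f s + e.
Proof.
move=> e0 fndecr fM.
pose E : set R := f @` [set t | 0 <= t].
have supE : has_sup E.
  split; first by exists (f 0), 0 => //=.
  by exists M => _ [t t0 <-]; exact: fM.
have [_ [T T0 <-] supT] := sup_adherent e0 supE.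
exists T => // s t Ts st; rewrite -ltrBlDr.
apply: le_lt_trans (lt_le_trans supT (fndecr _ _ T0 Ts)).
rewrite lerB// ub_le_sup//; first exact: (proj2 supE).
by exists t => //=; rewrite (le_trans T0)// (le_trans Ts).
Qed.

(** Compactness of boxes, applied to the transposed sequence of row vectors. *)
Lemma bounded_seq_cluster (R : realType) (d : nat) (z : nat -> 'cV[R]_d) (M : R) :
  (forall k j, `|z k j 0| <= M) ->
  exists y : 'cV[R]_d, forall e, 0 < e -> forall N,
    exists2 k, (N <= k)%N & forall j, `|y j 0 - z k j 0| < e.
Proof.
move=> zM.
have box_compact : compact [set v : 'rV[R]_d | forall j, `[- M, M]%classic (v ord0 j)].
  by apply: (@rV_compact _ _ (fun=> `[- M, M]%classic)) => _; exact: segment_compact.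
have [|v [_ vz]] := box_compact ((fun k => (z k)^T) @ \oo) _.
  by exists 0%N => // k _ j /=; rewrite mxE in_itv /= -ler_norml.
exists v^T => e e0 N.
have [|_ [[k Nk <-] /= zv]] :=
  vz ((fun k => (z k)^T) @` [set k | (N <= k)%N]) _ _ (nbhsx_ballx v e e0).
  by exists N => // k Nk; exists k.
exists k => // j; case: zv => _ /(_ 0 j).
by rewrite !mxE.
Qed.

(** * Limit points of a trajectory *)

Section OmegaLimit.
Variables (R : realType) (d p : nat) (B : 'I_p -> 'M[R]_d) (u : input R p).
Variable x : 'cV[R]_d.
Hypothesis B_dissipative : forall i, mx_nonpos ((B i)^T + B i).
Local Notation Q i := ((B i)^T + B i).

Lemma sym_kernelP i y : sym_kernel B i y <-> qform (Q i) y = 0.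
Proof.
split=> [yker|y0].
  by rewrite /qform -mulmxA yker mulmx0 mxE.
by apply: qform_eq0_kernel => //; rewrite linearD /= trmxK addrC.
Qed.

(** By continuity of the forms and finiteness of the modes, one [e] serves both as
    the radius of a neighbourhood of [y] and as the rate of dissipation there. *)
Lemma uniform_dissipation (J : set 'I_p) y :
  (forall i, J i -> ~ sym_kernel B i y) ->
  exists2 e : R, 0 < e & forall i (z : 'cV[R]_d), J i ->
    (forall j, `|y j 0 - z j 0| < e) -> qform (Q i) z + e <= 0.
Proof.
move=> yJ.
have : \forall e \near (0 : R)^'+, forall i (z : 'cV[R]_d), J i ->
    (forall j, `|y j 0 - z j 0| < e) -> qform (Q i) z + e <= 0.
  apply: filter_forall => i.
  have [Ji|nJi] := pselect (J i); last by apply: nearW => e z.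
  have qy : qform (Q i) y < 0.
    rewrite lt_neqAle B_dissipative andbT.
    by apply/eqP => /sym_kernelP; exact: yJ.
  have qy2 : qform (Q i) y < qform (Q i) y / 2 by lra.
  have : \forall z \near y, qform (Q i) z < qform (Q i) y / 2.
    exact: (cvgr_lt _ (@continuous_qform _ _ (Q i) y)).
  move=> /nbhs_ballP[r /= r0 yr].
  near=> e => z _ yz.
  have : qform (Q i) z < qform (Q i) y / 2.
    apply: yr; split=> // j k; rewrite ord1; apply: (lt_trans (yz j)).
    by near: e; exact: nbhs_right_lt.
  have : e < - qform (Q i) y / 2.
    by near: e; apply: nbhs_right_lt; lra.
  lra.
move=> H; near (0 : R)^'+ => e.
exists e; first by near: e; exact: nbhs_right_gt.
by near: e; exact: H.
Unshelve. all: by end_near. Qed.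

(** Otherwise, near [y], every persistent mode dissipates at a fixed rate [e]. Each
    late passage close to [y] lasts at least a fixed time [tau], almost all of which is
    spent in persistent modes, since the others have a finite total duration. The
    norm would drop by a fixed amount infinitely often. In the proof, [f] is [e] times the
    time spent in non-persistent modes minus the squared norm: it is bounded and
    nondecreasing, so it cannot grow by [e tau] at late times, yet it does. *)
Lemma omega_limit_sub_kernels :
  omega_limit B u x `<=` \bigcup_(i in persistent_modes u) sym_kernel B i.
Proof.
move=> y [t [t0 _ ty Xy]]; apply: contrapT => ynker.
have [i Ji yi|e e0 qe] := @uniform_dissipation (persistent_modes u) y.
  by apply: ynker; exists i.
have [L L0 Xlip] := flow_lipschitz u x B_dissipative.
(* Starting within [e / 2] of [y], a trajectory of speed at most [L] stays within
   [e] of [y] during the time [tau]. *)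
pose tau := e / (2 * L).
have tau0 : 0 < tau by rewrite divr_gt0// mulr_gt0.
pose w i : R := if i \in persistent_modes u then e else 0.
pose clock r := e * r - \sum_i w i * occupation_time u i r.
have clockE r : 0 <= r ->
    clock r = \sum_i (e - w i) * occupation_time u i r.
  move=> r0; rewrite /clock -{1}(sum_occupation_time u r0) mulr_sumr -sumrB.
  by apply: eq_bigr => i _; rewrite mulrBl.
have ew0 i : 0 <= e - w i.
  by rewrite /w; case: ifP; rewrite ?subrr ?subr0// ltW.
pose f r := clock r - sqnorm (flow B u r *m x).
have [|s r s0 sr|r r0|T T0 fT] := @bounded_ndecr_increment _ f
  (\sum_i (e - w i) * fine (lebesgue_measure (mode_set u i))) (e * tau).
- by rewrite mulr_gt0.
- rewrite lerB ?sqnorm_flow_nincr// !clockE ?(le_trans s0)//.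
  by apply: ler_sum => i _; rewrite ler_wpM2l// le_occupation_time.
- rewrite /f lerBlDr clockE// ler_wpDr ?sqnorm_ge0//.
  apply: ler_sum => i _; rewrite /w; case: ifPn => [_|iJ]; first by rewrite subrr !mul0r.
  rewrite subr0 ler_wpM2l ?(ltW e0)//; apply: occupation_time_le_measure; rewrite ltey.
  by apply: contra iJ => /eqP iJ; rewrite inE.
have [k [Tk yk]] : exists k, T <= t k /\
    forall j, `|y j 0 - (flow B u (t k) *m x) j 0| < e / 2.
  near \oo => k; exists k; split; first by near: k; move/cvgryPge : ty; exact.
  near: k; apply: filter_forall => j.
  move/cvg_mx_coord : Xy => /(_ j 0) /cvgrPdist_lt; apply; lra.
have := fT _ (t k + tau) Tk; rewrite lerDl ltW// => /(_ isT).
have := @energy_dissipation _ _ _ B u x w (t k) (t k + tau) (t0 k) _ _.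
rewrite lerDl ltW// => /(_ isT) H.
rewrite ltNge => /negP; apply; rewrite /f /clock mulrDr.
suff : sqnorm (flow B u (t k + tau) *m x) +
       \sum_i w i * occupation_time u i (t k + tau) <=
       sqnorm (flow B u (t k) *m x) + \sum_i w i * occupation_time u i (t k) by lra.
apply: H => r /andP[kr rk].
rewrite /w; case: ifPn => [|_]; last by rewrite addr0; exact: B_dissipative.
rewrite inE => Jr; apply: qe => // j.
have := Xlip _ _ j (t0 k) (ltW kr).
have : L * (r - t k) < e / 2.
  rewrite -ltr_pdivlMl// mulrC ltrBlDl (lt_le_trans rk)// lerD2l /tau.
  by rewrite invfM mulrA.
have := yk j; rewrite !ltr_norml ler_norml => /andP[? ?] ? /andP[? ?].
by apply/andP; split; lra.
Unshelve. all: by end_near. Qed.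

(** If the dissipation in mode [i] stayed above [e], the infinite time spent in this
    mode would exhaust the squared norm. The time obtained need not itself lie in mode
    [i]: the limit argument needs only the value of the form. *)
Lemma dissipation_vanishes i e T : persistent_modes u i -> 0 < e -> 0 <= T ->
  exists2 t, T <= t & - e < qform (Q i) (flow B u t *m x).
Proof.
move=> Ji e0 T0; apply: contrapT => diss.
have Xdiss t : T <= t -> qform (Q i) (flow B u t *m x) <= - e.
  by move=> Tt; rewrite leNgt; apply/negP => qt; apply: diss; exists t.
pose M := occupation_time u i T + sqnorm (flow B u T *m x) / e.
have [t t0 Mt] := occupation_time_unbounded M Ji.
have sqT := sqnorm_ge0 (flow B u T *m x).
have [tT|/ltW Tt] := leP t T.
  have := le_occupation_time u i tT; rewrite leNgt => /negP; apply.
  by rewrite (le_lt_trans _ Mt)// lerDl divr_ge0// ltW.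
pose w k : R := if k == i then e else 0.
have wE r : \sum_k w k * occupation_time u k r = e * occupation_time u i r.
  rewrite (bigD1 i)//= /w eqxx big1 ?addr0// => k /negPf ->.
  by rewrite mul0r.
have := @energy_dissipation _ _ _ B u x w T t T0 Tt; rewrite !wE => H.
have {H} : sqnorm (flow B u t *m x) + e * occupation_time u i t <=
          sqnorm (flow B u T *m x) + e * occupation_time u i T.
  apply: H => r /andP[Tr _]; rewrite /w; case: eqP => [->|_].
    by rewrite -lerBrDr sub0r Xdiss// ltW.
  by rewrite addr0; exact: B_dissipative.
apply/negP; rewrite -ltNge.
apply: lt_le_trans (_ : e * occupation_time u i t <= _); last by rewrite lerDr sqnorm_ge0.
by rewrite -ltr_pdivrMl// mulrDr mulrA mulVf ?gt_eqF// mul1r addrC mulrC.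
Qed.

(** An accumulation point of the states at which the form of mode [i] is nearly zero
    is a zero of this form, hence lies in the kernel. *)
Lemma omega_limit_cap_kernel i : persistent_modes u i ->
  omega_limit B u x `&` sym_kernel B i !=set0.
Proof.
move=> Ji.
have inv_gt0 k : 0 < (k.+1%:R)^-1 :> R by rewrite invr_gt0.
have /choice[t0 t0P] : forall k : nat, exists t, k%:R <= t /\
    - (k.+1%:R)^-1 < qform (Q i) (flow B u t *m x).
  by move=> k; have [t] := dissipation_vanishes Ji (inv_gt0 k) (ler0n _ k); exists t.
have t0_ge0 k : 0 <= t0 k by rewrite (le_trans _ (proj1 (t0P k))).
have [y yP] := @bounded_seq_cluster _ _ (fun k => flow B u (t0 k) *m x) (1 + sqnorm x)
  (fun k j => normr_flow_le u x B_dissipative j (t0_ge0 k)).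
(* The times [t0 k] need not increase; [h (k, T)] picks a good one after [T],
   with precision [1 / (k + 1)]. *)
have /choice[h hP] : forall kT : nat * R, exists t, [/\ kT.2 <= t,
    - (kT.1.+1%:R)^-1 < qform (Q i) (flow B u t *m x) &
    forall j, `|y j 0 - (flow B u t *m x) j 0| < (kT.1.+1%:R)^-1].
  move=> [k T] /=.
  have [m kTm my] := yP _ (inv_gt0 k) (maxn k (Num.truncn T).+1).
  move: kTm; rewrite geq_max => /andP[km Tm].
  exists (t0 m); split => //.
    apply: le_trans (proj1 (t0P m)); apply: ltW (lt_le_trans (truncnS_gt _) _).
    by rewrite ler_nat.
  apply: le_lt_trans (proj2 (t0P m)).
  by rewrite lerN2 lef_pV2 ?posrE// ler_nat.
pose t := fix t k := if k is k'.+1 then h (k, t k' + 1) else h (0%N, 0).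
have tS k : t k + 1 <= t k.+1 by have [] := hP (k.+1, t k + 1).
have tP k : - (k.+1%:R)^-1 < qform (Q i) (flow B u (t k) *m x) /\
    forall j, `|y j 0 - (flow B u (t k) *m x) j 0| < (k.+1%:R)^-1.
  by case: k => [|k]; [have [] := hP (0%N, 0)|have [] := hP (k.+1, t k + 1)].
have tk k : k%:R <= t k.
  elim: k => [|k IH]; first by have [] := hP (0%N, 0).
  by rewrite (le_trans _ (tS k))// -natr1 lerD2r.
have Xy : flow B u (t k) *m x @[k --> \oo] --> y.
  apply/cvg_mx_coord => j l; rewrite ord1; apply/cvgrPdist_lt => e e0.
  near=> k; apply: (lt_trans (proj2 (tP k) j)).
  by near: k; exact: near_infty_natSinv_lt (PosNum e0).
exists y; split.
  exists t; split=> //.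
  - by move=> k; rewrite (le_trans _ (tk k)).
  - by apply/increasing_seqP => k; rewrite (lt_le_trans _ (tS k))// ltrDl.
  - apply/cvgryPge => M; near=> k; apply: le_trans (tk k).
    by near: k; exact: nbhs_infty_ger.
apply/sym_kernelP/le_anti; rewrite B_dissipative /=.
have qy : qform (Q i) (flow B u (t k) *m x) @[k --> \oo] --> qform (Q i) y.
  exact: (cvg_comp _ _ Xy (@continuous_qform _ _ (Q i) y)).
rewrite -oppr0; apply: ler_cvg_to (cvgN (@cvg_harmonic R)) qy _.
by apply: nearW => k; exact: ltW (proj1 (tP k)).
Unshelve. all: by end_near. Qed.

End OmegaLimit.

Theorem theorem5 (R : realType) (d p : nat) (B : 'I_p -> 'M[R]_d)
    (hB : forall i : 'I_p, mx_nonpos ((B i)^T + B i))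
    (u : input R p) (x : 'cV[R]_d) :
  omega_limit B u x `<=` \bigcup_(i in persistent_modes u) sym_kernel B i /\
  (forall i : 'I_p, persistent_modes u i ->
     omega_limit B u x `&` sym_kernel B i !=set0).
Proof.
split; first exact: omega_limit_sub_kernels.
by move=> i; exact: omega_limit_cap_kernel.
Qed.
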